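(* Let $X$ be a compact torsion group and let $p$ be a prime number. Then $\mathrm{Ext}(X,F_p)=0$.
   Context: All groups are Hausdorff abelian topological groups, written additively. Let $\mathcal{L}$ be the category of locally compact abelian (LCA) groups with continuous homomorphisms as morphisms. A morphism is proper if it is open onto its image. A short exact sequence $0\to A\stackrel{\phi}{\to}B\stackrel{\psi}{\to}C\to 0$ in $\mathcal{L}$ is proper exact if $\phi$ and $\psi$ are proper; it is then called an extension of $A$ by $C$. For $A,C\in\mathcal{L}$, $\mathrm{Ext}(C,A)$ denotes the (discrete) abelian group of (equivalence classes of) extensions of $A$ by $C$ in $\mathcal{L}$, with Baer sum; $\mathrm{Ext}(C,A)=0$ means that every such extension splits. A group is torsion if each of its elements has finite order. $F_p$ is the additive topological group of $p$-adic numbers with its usual topology, i.e. the minimal divisible extension of the group $J_p$ of $p$-adic integers. *)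

(* Defs.v *)
From HB Require Import structures.
From mathcomp Require Import all_boot all_order all_algebra.
From mathcomp Require Import zify.
From mathcomp Require Import boolp classical_sets functions topology tvs.

Set Implicit Arguments.
Unset Strict Implicit.
Unset Printing Implicit Defensive.

Import Order.TTheory GRing.Theory Num.Theory.

Local Open Scope classical_set_scope.
Local Open Scope ring_scope.

Definition is_LCA (G : topologicalZmodType) : Prop :=
  hausdorff_space G /\ locally_compact [set: G].

Definition torsion (G : zmodType) : Prop :=
  forall x : G, exists2 n : nat, (0 < n)%N & x *+ n = 0.

(** The last clause says that [f] is open onto its image, i.e. images of open
    sets are relatively open in [range f], not necessarily open in [B]. *)
Definition proper_morphism (A B : topologicalZmodType) (f : {additive A -> B}) :
    Prop :=
  continuous f /\
  forall U : set A, open U -> exists2 V : set B, open V &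
    f @` U = V `&` range f.

(** [0 -> A -> ext_mid -> C -> 0] is an extension of [A] by [C]; note that the
    arguments of [Ext_trivial] below come in the opposite order, as in
    [Ext(C, A)]. *)
Record extension (A C : topologicalZmodType) := Extension {
  ext_mid : topologicalZmodType;
  ext_LCA : is_LCA ext_mid;
  ext_inj : {additive A -> ext_mid};
  ext_proj : {additive ext_mid -> C};
  ext_inj_proper : proper_morphism ext_inj;
  ext_proj_proper : proper_morphism ext_proj;
  ext_injective : injective ext_inj;
  ext_exact : range ext_inj = ext_proj @^-1` [set 0];
  ext_surjective : range ext_proj = [set: C]
}.

Definition splits (A C : topologicalZmodType) (E : extension A C) : Prop :=
  exists2 s : {additive C -> ext_mid E}, continuous s &
    forall c : C, ext_proj E (s c) = c.

(** [Ext(C, A) = 0]. *)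
Definition Ext_trivial (C A : topologicalZmodType) : Prop :=
  forall E : extension A C, splits E.

(** [padic_abs p x] is [p ^ - v_p(x)].  As [logn p] is zero when [p] is not
    prime, it is then the trivial absolute value, so that the construction
    below makes sense without assuming that [p] is prime. *)
Definition padic_abs (p : nat) (x : rat) : rat :=
  if x == 0 then 0
  else p%:R ^ ((logn p `|denq x|)%:Z - (logn p `|numq x|)%:Z).

Section PadicAbs.
Variable p : nat.
Local Notation abs := (padic_abs p).

Lemma padic_abs0 : abs 0 = 0.
Proof. by rewrite /padic_abs eqxx. Qed.

Lemma padic_absN x : abs (- x) = abs x.
Proof. by rewrite /padic_abs oppr_eq0 denqN numqN abszN. Qed.

Lemma padic_absB x y : abs (x - y) = abs (y - x).
Proof. by rewrite -padic_absN opprB. Qed.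

Lemma padic_abs_ratio (a b : int) : a != 0 -> b != 0 ->
  abs (a%:Q / b%:Q) = p%:R ^ ((logn p `|b|)%:Z - (logn p `|a|)%:Z).
Proof.
move=> a0 b0; rewrite /padic_abs mulf_eq0 invr_eq0 !intr_eq0.
rewrite (negbTE a0) (negbTE b0) /=; set x := _ / _.
have x0 : numq x != 0.
  by rewrite numq_eq0 /x mulf_eq0 invr_eq0 !intr_eq0 (negbTE a0) (negbTE b0).
have E : numq x * b = a * denq x.
  apply/eqP; rewrite -(eqr_int rat) !rmorphM /=.
  have d0 : (denq x)%:Q != 0 by rewrite intr_eq0.
  have b0' : b%:Q != 0 by rewrite intr_eq0.
  have xE : (numq x)%:Q = x * (denq x)%:Q by rewrite -{2}[x]divq_num_den divfK.
  by rewrite xE {1}/x mulrAC divfK.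
have : logn p `|(numq x * b)%R|%N = logn p `|(a * denq x)%R|%N by rewrite E.
rewrite /= !abszM !lognM ?absz_gt0 //.
by move=> EL; congr (_ ^ _); lia.
Qed.

Lemma logn_nonprime n : ~~ prime p -> logn p n = 0%N.
Proof. by move=> npr; rewrite lognE (negbTE npr). Qed.

Lemma logn_addz_min (a b : int) : a + b != 0 -> a != 0 -> b != 0 ->
  (minn (logn p `|a|) (logn p `|b|) <= logn p `|(a + b)%R|)%N.
Proof.
move=> ab0 a0 b0; have [pr|npr] := boolP (prime p); last first.
  by rewrite !logn_nonprime.
set m := minn _ _; rewrite -pfactor_dvdn ?absz_gt0 //.
have : ((p ^ m)%:Z %| a + b)%Z.
  by rewrite rpredD // dvdzE /= pfactor_dvdn ?absz_gt0 ?geq_minl ?geq_minr.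
by rewrite dvdzE.
Qed.

Lemma padic_exp_le (i j : nat) (k : int) :
    (prime p -> j <= i)%N ->
  (~ prime p -> i = 0%N /\ j = 0%N) ->
  (p%:R : rat) ^ (k - i%:Z) <= p%:R ^ (k - j%:Z).
Proof.
move=> H1 H2; have [pr|npr] := boolP (prime p); last first.
  by have [-> ->] := H2 (negP npr).
by apply: ler_weXz2l; rewrite ?ler1n ?prime_gt0 // lerD2l lerN2 lez_nat H1.
Qed.

Lemma padic_absD (x y e : rat) : abs x < e -> abs y < e -> abs (x + y) < e.
Proof.
have [->|x0] := eqVneq x 0; first by rewrite add0r.
have [->|y0] := eqVneq y 0; first by rewrite addr0.
have [->|xy0] := eqVneq (x + y) 0.
  rewrite padic_abs0 => + _; apply: le_lt_trans.
  by rewrite /padic_abs (negbTE x0) exprz_ge0 // ler0n.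
pose d := denq x * denq y; pose a := numq x * denq y; pose b := numq y * denq x.
have dx0 : (denq x)%:Q != 0 by rewrite intr_eq0.
have dy0 : (denq y)%:Q != 0 by rewrite intr_eq0.
have d0 : d != 0 by rewrite mulf_neq0.
have dQ0 : d%:Q != 0 by rewrite intr_eq0.
have a0 : a != 0 by rewrite mulf_neq0 ?numq_eq0.
have b0 : b != 0 by rewrite mulf_neq0 ?numq_eq0.
have xE : x = a%:Q / d%:Q.
  apply: (canRL (mulfK dQ0)); rewrite /a /d !rmorphM /= mulrA.
  by rewrite -{1}(divq_num_den x) divfK.
have yE : y = b%:Q / d%:Q.
  apply: (canRL (mulfK dQ0)); rewrite /b /d !rmorphM /= (mulrC (denq x)%:Q) mulrA.
  by rewrite -{1}(divq_num_den y) divfK.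
have sE : x + y = (a + b)%:Q / d%:Q by rewrite {1}xE {1}yE -mulrDl -rmorphD.
have ab0 : a + b != 0.
  by apply: contra_neq xy0 => ab0; rewrite sE ab0 mul0r.
rewrite sE {1}xE {1}yE !padic_abs_ratio //.
have := logn_addz_min ab0 a0 b0.
rewrite geq_min => /orP[le|le] ha hb.
- by apply: le_lt_trans ha; apply: padic_exp_le => // /negP npr; rewrite !logn_nonprime.
- by apply: le_lt_trans hb; apply: padic_exp_le => // /negP npr; rewrite !logn_nonprime.
Qed.

End PadicAbs.

Definition padic_cauchy (p : nat) : {pred nat -> rat} :=
  [pred u : nat -> rat | `[< forall e : rat, 0 < e -> exists N : nat,
     forall m n : nat, (N <= m)%N -> (N <= n)%N ->
       padic_abs p (u m - u n) < e >]].

Lemma padic_cauchy_zmod_closed (p : nat) : zmod_closed (padic_cauchy p).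
Proof.
split=> [|u v /asboolP hu /asboolP hv]; apply/asboolP => e e0.
  by exists 0%N => m n _ _; rewrite subrr padic_abs0.
have [N1 h1] := hu e e0; have [N2 h2] := hv e e0.
exists (maxn N1 N2) => m n; rewrite !geq_max => /andP[m1 m2] /andP[n1 n2].
rewrite !fctE opprD addrACA padic_absD ?h1 //.
by rewrite -opprD padic_absN h2.
Qed.

HB.instance Definition _ (p : nat) :=
  GRing.isZmodClosed.Build (nat -> rat) (padic_cauchy p)
    (padic_cauchy_zmod_closed p).

Record padic_seq (p : nat) := PadicSeq {
  padic_seq_val :> nat -> rat;
  _ : padic_seq_val \in padic_cauchy p
}.

HB.instance Definition _ (p : nat) := [isSub for @padic_seq_val p].
HB.instance Definition _ (p : nat) := [Choice of padic_seq p by <:].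
HB.instance Definition _ (p : nat) :=
  [SubChoice_isSubZmodule of padic_seq p by <:].

Definition padic_null (p : nat) : {pred padic_seq p} :=
  [pred u : padic_seq p | `[< forall e : rat, 0 < e -> exists N : nat,
     forall n : nat, (N <= n)%N -> padic_abs p (u n) < e >]].

Lemma padic_null_zmod_closed (p : nat) : zmod_closed (@padic_null p).
Proof.
split=> [|u v /asboolP hu /asboolP hv]; apply/asboolP => e e0.
  by exists 0%N => n _; rewrite padic_abs0.
have [N1 h1] := hu e e0; have [N2 h2] := hv e e0.
exists (maxn N1 N2) => n; rewrite geq_max => /andP[n1 n2].
by rewrite padic_absD ?padic_absN ?h1 ?h2.
Qed.

HB.instance Definition _ (p : nat) :=
  GRing.isZmodClosed.Build (padic_seq p) (@padic_null p)
    (padic_null_zmod_closed p).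

(** The p-adic numbers, as the completion of [rat] for [padic_abs p]: Cauchy
    sequences modulo null sequences. *)
Definition padic (p : nat) : Type := Quotient.quot (@padic_null p).

HB.instance Definition _ (p : nat) := GRing.Zmodule.on (padic p).

Section PadicTopology.
Variable p : nat.
Local Notation Qp := (padic p).
Implicit Types (x y z : Qp) (e : rat).

Definition padic_mk (u : padic_seq p) : Qp := \pi_(Qp)%qT u.

(** For Cauchy sequences [u] and [v], [padic_abs p (u n - v n)] is eventually
    constant or tends to [0], so that it is eventually below [e > 0] if and
    only if its limit, the distance of the classes, is below [e].  This does
    not depend on the representatives, see [padic_ball_mk]. *)
Definition padic_ball x e y : Prop :=
  exists N : nat, forall n : nat, (N <= n)%N ->
    padic_abs p ((repr x : padic_seq p) n - (repr y : padic_seq p) n) < e.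

Lemma padic_reprK x : padic_mk (repr x) = x.
Proof. exact: reprK. Qed.

Lemma padic_mkP (u v : padic_seq p) :
  (padic_mk u = padic_mk v) <-> (u - v \in @padic_null p).
Proof.
rewrite /padic_mk; split=> [/eqP|h]; first by rewrite Quotient.idealrBE.
by apply/eqP; rewrite -Quotient.idealrBE.
Qed.

Lemma padic_mkB (u v : padic_seq p) :
  padic_mk (u - v) = padic_mk u - padic_mk v.
Proof. exact: (raddfB (\pi_Qp%qT : padic_seq p -> Qp)). Qed.

Lemma padic_ball_mk (u v : padic_seq p) e : 0 < e ->
  padic_ball (padic_mk u) e (padic_mk v) <->
  exists N : nat, forall n : nat, (N <= n)%N -> padic_abs p (u n - v n) < e.
Proof.
move=> e0; rewrite /padic_ball; set u' := repr _; set v' := repr _.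
have reprN (w : padic_seq p) : exists N : nat, forall n : nat, (N <= n)%N ->
    padic_abs p ((repr (padic_mk w) : padic_seq p) n - w n) < e.
  have /padic_mkP/asboolP/(_ e e0)[N hN] := padic_reprK (padic_mk w).
  by exists N.
have [Nu hu] := reprN u; have [Nv hv] := reprN v.
split=> -[N hN]; exists (maxn N (maxn Nu Nv)) => n;
  rewrite !geq_max => /and3P[nN nu nv].
- have -> : u n - v n = (u n - u' n) + ((u' n - v' n) + (v' n - v n)).
    by rewrite !subrKA.
  by apply: padic_absD; [rewrite padic_absB hu|rewrite padic_absD ?hN ?hv].
- have -> : u' n - v' n = (u' n - u n) + ((u n - v n) + (v n - v' n)).
    by rewrite !subrKA.
  by apply: padic_absD; [rewrite hu|rewrite padic_absD ?hN // padic_absB hv].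
Qed.

Lemma padic_ball_gt0 x y e : padic_ball x e y -> 0 < e.
Proof.
move=> [N hN]; apply: le_lt_trans (hN N (leqnn N)).
by rewrite /padic_abs; case: ifP => // _; rewrite exprz_ge0 // ler0n.
Qed.

Lemma padic_ball_center x e : 0 < e -> padic_ball x e x.
Proof. by move=> e0; exists 0%N => n _; rewrite subrr padic_abs0. Qed.

Lemma padic_ball_sym x y e : padic_ball x e y -> padic_ball y e x.
Proof. by move=> [N hN]; exists N => n /hN; rewrite padic_absB. Qed.

Lemma padic_ball_triangle x y z e1 e2 :
  padic_ball x e1 y -> padic_ball y e2 z -> padic_ball x (e1 + e2) z.
Proof.
move=> b1 b2; have e1_gt0 := padic_ball_gt0 b1.
have e2_gt0 := padic_ball_gt0 b2; move: b1 b2 => [N1 h1] [N2 h2].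
exists (maxn N1 N2) => n; rewrite geq_max => /andP[n1 n2].
rewrite -(subrKA ((repr y : padic_seq p) n)) padic_absD //.
  by rewrite (lt_le_trans (h1 _ n1)) // lerDl ltW.
by rewrite (lt_le_trans (h2 _ n2)) // lerDr ltW.
Qed.

Lemma padic_ballB x y z t e : padic_ball x e y -> padic_ball z e t ->
  padic_ball (x - z) e (y - t).
Proof.
move=> b1 b2; have e0 := padic_ball_gt0 b1; move: b1 b2.
rewrite -(padic_reprK x) -(padic_reprK y) -(padic_reprK z) -(padic_reprK t).
move: (repr x) (repr y) (repr z) (repr t) => u u' v v'.
rewrite -!padic_mkB !padic_ball_mk // => -[N1 h1] [N2 h2].
exists (maxn N1 N2) => n; rewrite geq_max => /andP[n1 n2].
have -> : (u - v) n - (u' - v') n = (u n - u' n) - (v n - v' n).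
  by rewrite -[(u - v) n]/(u n - v n) -[(u' - v') n]/(u' n - v' n) opprD
             addrACA -opprD.
by rewrite padic_absD ?padic_absN ?h1 ?h2.
Qed.

Definition padic_ent : set_system (Qp * Qp) := entourage_ padic_ball.

End PadicTopology.

HB.instance Definition _ (p : nat) :=
  hasNbhs.Build (padic p) (nbhs_ (@padic_ent p)).
HB.instance Definition _ (p : nat) :=
  @Nbhs_isPseudoMetric.Build rat (padic p) (@padic_ent p) erefl
    (@padic_ball p) (@padic_ball_center p) (@padic_ball_sym p)
    (@padic_ball_triangle p) erefl.

Lemma padic_sub_continuous (p : nat) :
  continuous (fun x : padic p * padic p => x.1 - x.2).
Proof.
move=> [x y] /= A; rewrite -!nbhs_ballE => -[e /= e0 sA].
exists e => //= -[z t] /= [b1 b2]; apply: sA; exact: padic_ballB.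
Qed.

HB.instance Definition _ (p : nat) :=
  PreTopologicalNmodule_isTopologicalZmodule.Build (padic p)
    (@padic_sub_continuous p).

(* Main.v *)
From HB Require Import structures.
Require Import Defs.
From mathcomp Require Import all_boot all_order all_algebra.
From mathcomp Require Import boolp classical_sets functions topology tvs.

(** A compact torsion group [X] has bounded exponent: the closed sets
    [{x | n x = 0}], for [n > 0], cover [X], so by Baire's theorem one of them
    has interior, hence is an open subgroup, and by compactness it has finite
    index ([compact_torsion_bounded]).  Let [N > 0] kill [X].

    On the other hand multiplication by [N] is an automorphism of the
    topological group of p-adic numbers, its inverse being the scaling by the
    rational number [1 / N] ([padic_scale_continuous], [padic_scale_invMn]).

    These two facts split any extension [0 -> F_p -i-> B -q-> X -> 0]
    ([bounded_splits]): multiplication by [N] sends [B] into [ker q = range i],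
    so [r b = (1 / N) i^-1 (N b)] is a continuous homomorphism from [B] to
    [F_p] with [r (i a) = a].  Thus [b - i (r b)] depends only on [q b], and
    as [q] is open, this defines a continuous section of [q]. *)

Set Implicit Arguments.
Unset Strict Implicit.
Unset Printing Implicit Defensive.

Import Order.TTheory GRing.Theory Num.Theory.

Local Open Scope classical_set_scope.
Local Open Scope ring_scope.

(** Baire's theorem, in the form where a countable closed cover of a nonempty
    compact Hausdorff space has a member with nonempty interior.  If all the
    interiors were empty, regularity would give a decreasing sequence of
    nonempty open sets [U n], the closure of [U n.+1] lying in [U n] and
    avoiding [F n]; a cluster point of this sequence would be in no [F n]. *)
Lemma compact_Baire (T : topologicalType) (F : nat -> set T) (x0 : T) :
  hausdorff_space T -> compact [set: T] -> (forall n, closed (F n)) ->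
  (forall x, exists n, F n x) -> exists n, (F n)° !=set0.
Proof.
move=> hT cT clF covF; apply: contrapT => /forallNP nF.
(* The implication is put inside the existential so that [choice] yields a
   total function. *)
have shrink (nU : nat * set T) : exists V : set T, open nU.2 -> nU.2 !=set0 ->
    [/\ open V, V !=set0 & closure V `<=` nU.2 `\` F nU.1].
  have [oU|] := pselect (open nU.2); last by exists set0.
  have [[u Uu]|] := pselect (nU.2 !=set0); last by exists set0.
  have [y [Uy nFy]] : (nU.2 `\` F nU.1) !=set0.
    apply: contrapT => empty; apply: (nF nU.1); exists u.
    rewrite /interior /= nbhsE; exists nU.2 => // z Uz; apply: contrapT => nFz.
    by apply: empty; exists z.
  have oUF : open (nU.2 `\` F nU.1) by apply: openI => //; exact: closed_openC.
  have yT : nbhs y [set: T] by exact: filterT.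
  have [|W Wy WUF] := @compact_regular _ y _ hT cT yT (nU.2 `\` F nU.1).
    exact: open_nbhs_nbhs.
  exists W°; split; first exact: open_interior.
    by exists y.
  by apply: subset_trans WUF; apply: closureS; exact: interior_subset.
have [next nextP] := choice shrink.
pose U := fix U n := if n is m.+1 then next (m, U m) else [set: T].
have U0 n : open (U n) /\ U n !=set0.
  elim: n => [|n [oU nU]]; first by split; [exact: openT | exists x0].
  by have [] := nextP (n, U n) oU nU.
have US n : closure (U n.+1) `<=` U n `\` F n.
  by have [oU nU] := U0 n; have [] := nextP (n, U n) oU nU.
have Umono m n : (m <= n)%N -> U n `<=` U m.
  move=> /subnK <-; elim: (n - m)%N => // k IH.
  by apply: subset_trans IH => x /subset_closure/US[].
have PF : ProperFilter (filter_from [set: nat] U).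
  apply: filter_from_proper; last by move=> n _; have [] := U0 n.
  apply: filter_from_filter; first by exists 0%N.
  move=> m n _ _; exists (maxn m n) => // x Ux.
  by split; apply: Umono Ux; rewrite ?leq_maxl ?leq_maxr.
have [|x [_ clx]] := cT _ PF; first by exists 0%N.
have [n Fnx] := covF x.
have /US[] // : closure (U n.+1) x.
by move=> B; apply: clx; exists n.+1.
Qed.

Lemma continuous_mulrn (G : topologicalZmodType) n :
  continuous (fun x : G => x *+ n).
Proof.
elim: n => [|n IH] x; first exact: cvg_cst.
have -> : (fun x : G => x *+ n.+1) = (fun x : G => x + x *+ n).
  by apply/funext => y; rewrite mulrS.
apply: (@continuous_comp _ _ _ (fun x : G => (x, x *+ n)) (fun x => x.1 + x.2)).
  by apply: cvg_pair; [exact: cvg_id | exact: IH].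
exact: add_continuous.
Qed.

(** Once [{x | n.+1 x = 0}] has an interior point [a], a translation shows that
    near any [x] the multiple [n.+1 z] is equal to [n.+1 x], hence is killed by
    the order [m] of [x], and by [k`!] for all [k >= m].  The multiples
    [n.+1 * k`!] are thus locally eventually an exponent, and by compactness
    they are so globally for [k] large. *)
Lemma compact_torsion_bounded (X : topologicalZmodType) :
  hausdorff_space X -> compact [set: X] -> torsion X ->
  exists2 N, (0 < N)%N & forall x : X, x *+ N = 0.
Proof.
move=> hX cX tX.
have [n [a Fa]] : exists n, [set x : X | x *+ n.+1 = 0]° !=set0.
  apply: (@compact_Baire X (fun n => [set x | x *+ n.+1 = 0]) 0) => // [n|x].
    apply: (@closed_comp _ _ (fun x : X => x *+ n.+1) [set 0]).
      by move=> x _; exact: continuous_mulrn.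
    exact/accessible_closed_set1/hausdorff_accessible.
  by have [[//|n] _ xn] := tX x; exists n.
have /compact_near_coveringP
  /(_ nat \oo (fun k x => x *+ (n.+1 * k`!) = 0) _) := cX.
case=> [x _|N _ hN]; last first.
  exists (n.+1 * N`!)%N; first by rewrite muln_gt0 fact_gt0.
  by move=> x; exact: (hN N (leqnn N) x).
have [m m0 xm] := tX x.
have cont : {for x, continuous (fun z : X => z - x + a)}.
  apply: (@continuous_comp _ _ _
    (fun z : X => (z - x, a)) (fun u : X * X => u.1 + u.2)).
    apply: cvg_pair; last exact: cvg_cst.
    apply: (@continuous_comp _ _ _
      (fun z : X => (z, x)) (fun u : X * X => u.1 - u.2)).
      by apply: cvg_pair; [exact: cvg_id | exact: cvg_cst].
    exact: sub_continuous.
  exact: add_continuous.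
exists ((fun z : X => z - x + a) @^-1` [set y : X | y *+ n.+1 = 0],
        [set k | (m <= k)%N]).
  split => /=; last exact: nbhs_infty_ge.
  by apply: cont; rewrite /= subrr add0r.
case=> z k [/= zn mk].
have an : a *+ n.+1 = 0 := nbhs_singleton Fa.
have {}zn : z *+ n.+1 = x *+ n.+1.
  by apply/eqP; rewrite -subr_eq0 -mulrnBl -zn [X in _ == X]mulrnDl an addr0.
have /dvdnP[q ->] : (m %| k`!)%N by rewrite dvdn_fact // m0.
by rewrite mulrnA zn -mulrnA mulnA mulnC mulrnA xm mul0rn.
Qed.

Lemma padic_abs_ge0 p x : 0 <= padic_abs p x.
Proof. by rewrite /padic_abs; case: ifP => // _; rewrite exprz_ge0 ?ler0n. Qed.

Lemma padic_absM p x y : prime p ->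
  padic_abs p (x * y) = padic_abs p x * padic_abs p y.
Proof.
move=> pp.
have [->|x0] := eqVneq x 0; first by rewrite mul0r padic_abs0 mul0r.
have [->|y0] := eqVneq y 0; first by rewrite mulr0 padic_abs0 mulr0.
have nx : numq x != 0 by rewrite numq_eq0.
have ny : numq y != 0 by rewrite numq_eq0.
have p0 : p%:R != 0 :> rat by rewrite pnatr_eq0 -lt0n prime_gt0.
rewrite -{1}(divq_num_den x) -{1}(divq_num_den y) mulf_div -!rmorphM /=.
rewrite padic_abs_ratio ?mulf_neq0 ?denq_neq0 //.
rewrite /padic_abs (negbTE x0) (negbTE y0) -expfzDr //.
rewrite !abszM !lognM ?absz_gt0 ?denq_neq0 //.
by rewrite !PoszD opprD addrACA.
Qed.

(** The uniform estimate behind everything about scaling: it makes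
    multiplication by [c] preserve Cauchy sequences and null sequences, and
    be continuous on the completion. *)
Lemma padic_scale_small p (c e : rat) : prime p -> 0 < e ->
  exists2 d : rat, 0 < d &
    forall x, padic_abs p x < d -> padic_abs p (c * x) < e.
Proof.
move=> pp e0; have [c0|c0] := eqVneq (padic_abs p c) 0.
  by exists 1 => // x _; rewrite padic_absM // c0 mul0r.
have cp : 0 < padic_abs p c by rewrite lt_def c0 padic_abs_ge0.
exists (e / padic_abs p c); first exact: divr_gt0.
by move=> x; rewrite padic_absM // ltr_pdivlMr // mulrC.
Qed.

Section PadicScale.
Variables (p : nat) (p_prime : prime p) (c : rat).

Lemma padic_cauchyZ (u : padic_seq p) :
  (fun n => c * u n) \in padic_cauchy p.
Proof.
case: u => u /= /asboolP hu; apply/asboolP => e e0.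
have [d d0 hd] := padic_scale_small c p_prime e0.
have [N hN] := hu d d0.
by exists N => m n mN nN; rewrite -mulrBr hd ?hN.
Qed.

Definition padic_seq_scale (u : padic_seq p) : padic_seq p :=
  PadicSeq (padic_cauchyZ u).

Definition padic_scale (x : padic p) : padic p :=
  padic_mk (padic_seq_scale (repr x)).

Lemma padic_scale_mk u :
  padic_scale (padic_mk u) = padic_mk (padic_seq_scale u).
Proof.
apply/padic_mkP/asboolP => e e0.
have [d d0 hd] := padic_scale_small c p_prime e0.
have /padic_mkP/asboolP/(_ d d0)[N hN] := padic_reprK (padic_mk u).
by exists N => n /hN/hd; rewrite mulrBr.
Qed.

Lemma padic_scale_is_zmod_morphism : zmod_morphism padic_scale.
Proof.
move=> x y; rewrite -(padic_reprK x) -(padic_reprK y) -padic_mkB !padic_scale_mk.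
rewrite -padic_mkB; congr padic_mk; apply/val_inj/funext => n /=.
exact: mulrBr.
Qed.

HB.instance Definition _ :=
  GRing.isZmodMorphism.Build (padic p) (padic p) padic_scale
    padic_scale_is_zmod_morphism.

Lemma padic_scale_continuous : continuous padic_scale.
Proof.
move=> x A /=; rewrite -!nbhs_ballE => -[e /= e0 sA].
have [d d0 hd] := padic_scale_small c p_prime e0.
exists d => //= y xy; apply: sA; move: xy.
rewrite -(padic_reprK x) -(padic_reprK y) /ball /= !padic_scale_mk.
move: (repr x) (repr y) => u v; rewrite !padic_ball_mk // => -[N hN].
by exists N => n /hN/hd; rewrite mulrBr.
Qed.

End PadicScale.

Lemma padic_mkMn p (u : padic_seq p) n : padic_mk u *+ n = padic_mk (u *+ n).
Proof. exact/esym/(raddfMn (\pi_(padic p)%qT : padic_seq p -> padic p)). Qed.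

Lemma padic_scale_invMn p (p_prime : prime p) N (x : padic p) : (0 < N)%N ->
  padic_scale p_prime N%:R^-1 x *+ N = x.
Proof.
move=> N0; rewrite -(padic_reprK x) padic_scale_mk padic_mkMn.
congr padic_mk; apply/val_inj/funext => n.
have valMn (u : padic_seq p) k : (u *+ k) n = u n *+ k.
  by elim: k => [|k IH]; rewrite ?mulrS -?IH.
by rewrite /= valMn /= -[LHS]mulr_natl mulVKf // pnatr_eq0 -lt0n.
Qed.

(** The map [div] is a continuous division by [N] on [A]; being additive it is
    also a left inverse of multiplication by [N], so that [A] has no
    [N]-torsion.  The retraction [r b = div (i^-1 (N b))] is continuous because
    [i] is open onto its image, and the section [c |-> b - i (r b)], for any
    [b] above [c], is continuous because [q] is open. *)
Lemma bounded_splits (A C : topologicalZmodType) (N : nat)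
    (div : {additive A -> A}) (E : extension A C) :
  continuous div -> (forall a, div a *+ N = a) -> (forall c : C, c *+ N = 0) ->
  splits E.
Proof.
move=> cdiv divK CN.
case: E => M LM i q [ci oi] [cq oq] injE exE surE; rewrite /splits /=.
have toker b : exists a, i a = b *+ N.
  have : (q @^-1` [set 0]) (b *+ N) by rewrite /= raddfMn CN.
  by rewrite -exE => -[a _ <-]; exists a.
have [t tE] := choice toker.
pose r b := div (t b).
have rB : zmod_morphism r.
  move=> x y; rewrite /r -raddfB; congr (div _); apply: injE.
  by rewrite raddfB !tE mulrnBl.
have ri a : r (i a) = a.
  have -> : r (i a) = div (a *+ N).
    by congr (div _); apply: injE; rewrite tE raddfMn.
  by rewrite raddfMn divK.
(* As [i] is open onto its image, [i (div^-1 O)] is the trace on [range i] of an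
   open set [V], and [r^-1 O] is the preimage of [V] under [b |-> N b]. *)
have cr : continuous r.
  apply/continuousP => O oO.
  have oD : open (div @^-1` O) by move/continuousP: cdiv; apply.
  have [V oV VE] := oi _ oD.
  have -> : r @^-1` O = (fun b => b *+ N) @^-1` V.
    apply/seteqP; split=> b /=.
      move=> Orb; have : (i @` (div @^-1` O)) (b *+ N) by exists (t b).
      by rewrite VE => -[].
    move=> Vb; have : (V `&` range i) (b *+ N) by split=> //; exists (t b).
    by rewrite -VE => -[a /= Oa]; rewrite -tE /r => /injE <-.
  by move/continuousP: (@continuous_mulrn M N); apply.
pose g b := b - i (r b).
have gB : zmod_morphism g.
  move=> x y; rewrite /g rB raddfB !opprB addrACA [RHS]addrACA.
  by congr (_ + _); rewrite addrC.
have cg : continuous g.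
  move=> b; apply: (@continuous_comp _ _ _
    (fun b => (b, i (r b))) (fun u : M * M => u.1 - u.2)).
    apply: cvg_pair; first exact: cvg_id.
    by apply: continuous_comp; [exact: cr | exact: ci].
  exact: sub_continuous.
have qi a : q (i a) = 0.
  by have : range i (i a) by []; rewrite exE.
have gker b : q b = 0 -> g b = 0.
  move=> qb; have : (q @^-1` [set 0]) b by [].
  by rewrite -exE => -[a _ <-]; rewrite /g ri subrr.
have lift c : exists b, q b = c.
  have : [set: C] c by [].
  by rewrite -surE => -[b _ <-]; exists b.
have [l lE] := choice lift.
have gl b : g (l (q b)) = g b.
  by apply/eqP; rewrite -subr_eq0 -gB gker // raddfB lE subrr.
have sB : zmod_morphism (g \o l).
  by move=> x y /=; rewrite -gB -(gl (l x - l y)) raddfB !lE.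
(* The lift [l] is arbitrary and need not be additive or continuous: these
   properties of [g \o l] come from [gl], as [g] depends only on the image
   under [q]. *)
pose s : {additive C -> M} :=
  HB.pack (g \o l) (GRing.isZmodMorphism.Build C M (g \o l) sB).
exists s => [|c]; last by rewrite /= /g raddfB qi subr0 lE.
apply/continuousP => O oO.
have og : open (g @^-1` O) by move/continuousP: cg; apply.
have [V oV] := oq _ og; rewrite surE setIT => VE.
suff -> : s @^-1` O = V by [].
rewrite -VE; apply/seteqP; split=> c /=; first by exists (l c).
by case=> b Ob <-; rewrite gl.
Qed.

Theorem lemma1p2 (X : topologicalZmodType) (p : nat)
    (X_hausdorff : hausdorff_space X) (X_compact : compact [set: X]%classic)
    (X_torsion : torsion X) (p_prime : prime p) :
  Ext_trivial X (padic p).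
Proof.
have [N N0 XN] := compact_torsion_bounded X_hausdorff X_compact X_torsion.
move=> E; apply: (bounded_splits (div := padic_scale p_prime N%:R^-1)) XN.
  exact: padic_scale_continuous.
by move=> a; exact: padic_scale_invMn.
Qed.
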